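(* Let $q$ be a power of an odd prime and let $a,b\in\mathbb{F}_q^{\times}$ be such that $a\neq b$. Then $$\psi_{(2,2)}(a,b):=\sum_{x\in\mathbb{F}_q}\phi(x^2+a)\phi(x^2+b)=q\,\phi(b)\cdot {}_2F_1\left(\begin{matrix}\phi&\phi\\ {}&\epsilon\end{matrix}\Big|\frac{a}{b}\right)-1.$$
   Context: Throughout, $p$ is an odd prime and $q=p^r$ with $r\ge 1$. A multiplicative character $\chi$ on $\mathbb{F}_q$ is a homomorphism $\mathbb{F}_q^\times\to\mathbb{C}^\times$, extended by $\chi(0)=0$. $\epsilon$ is the trivial character ($\epsilon(x)=1$ for $x\neq0$, $\epsilon(0)=0$) and $\phi$ is the quadratic character ($\phi(0)=0$). $\overline{B}=1/B$ denotes the inverse character. For characters $A,B$ put $J(A,B)=\sum_{x\in\mathbb{F}_q}A(x)B(1-x)$ and $\binom{A}{B}=\frac{B(-1)}{q}J(A,\overline{B})$. For characters $A_0,A_1,B_1$ and $x\in\mathbb{F}_q$, the Gaussian hypergeometric series is $${}_2F_1\left(\begin{matrix}A_0&A_1\\ {}&B_1\end{matrix}\Big|x\right)=\frac{q}{q-1}\sum_{\chi}\binom{A_0\chi}{\chi}\binom{A_1\chi}{B_1\chi}\chi(x),$$ the sum being over all multiplicative characters $\chi$ of $\mathbb{F}_q$. *)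

(* Defs.v *)
From HB Require Import structures.
From mathcomp Require Import all_boot all_order all_algebra all_field.
From mathcomp Require Import classical_sets boolp functions cardinality fsbigop.
From mathcomp Require Import reals.
From mathcomp Require Import complex.

Set Implicit Arguments.
Unset Strict Implicit.
Unset Printing Implicit Defensive.

Import Order.TTheory GRing.Theory Num.Theory.

Local Open Scope classical_set_scope.
Local Open Scope ring_scope.

Section Characters.
Variables (R : realType) (F : finFieldType).

(* The complex numbers are R[i], with R the real numbers.  Functions F -> R[i]
   form a ring under the pointwise operations, so that A * B is the product of
   characters; note that the unit of this ring, the constant function 1, is
   not the trivial character. *)
Definition mulchars : set {ffun F -> R[i]} :=
  [set chi | [/\ chi 0 = 0,
     forall x, x != 0 -> chi x != 0 &
     forall x y, x != 0 -> y != 0 -> chi (x * y) = chi x * chi y]].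

Definition epsilon : {ffun F -> R[i]} := [ffun x => if x == 0 then 0 else 1].

Definition quadchar : {ffun F -> R[i]} :=
  [ffun x => if x == 0 then 0 else if [exists y, x == y ^+ 2] then 1 else -1].

(* In R[i], 0^-1 = 0, so this keeps the value 0 at 0. *)
Definition invchar (B : {ffun F -> R[i]}) : {ffun F -> R[i]} :=
  [ffun x => (B x)^-1].

Definition jacobi_sum (A B : {ffun F -> R[i]}) : R[i] :=
  \sum_(x : F) A x * B (1 - x).

Definition char_binom (A B : {ffun F -> R[i]}) : R[i] :=
  B (-1) / #|F|%:R * jacobi_sum A (invchar B).

Definition hypergeo2F1 (A0 A1 B1 : {ffun F -> R[i]}) (x : F) : R[i] :=
  #|F|%:R / (#|F|%:R - 1) *
  \sum_(chi \in mulchars)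
    char_binom (A0 * chi) chi * char_binom (A1 * chi) (B1 * chi) * chi x.

(* \sum_(_ \in _) is 0 by convention over an infinite support; finiteness of
   the set of characters makes the sum above a genuine one. *)
Lemma finite_mulchars : finite_set mulchars.
Proof.
have [r hr] := closed_field_poly_normal ('X^#|F| - 'X : {poly R[i]}).
have q1 : (1 < #|F|)%N by exact: finNzRing_gt1.
have szp : size ('X^#|F| - 'X : {poly R[i]}) = #|F|.+1.
  by rewrite size_polyDl ?size_polyXn // size_polyN size_polyX ltnS.
have lcp : lead_coef ('X^#|F| - 'X : {poly R[i]}) = 1.
  by rewrite lead_coefDl ?lead_coefXn // size_polyN size_polyX size_polyXn ltnS.
rewrite lcp scale1r in hr.
pose f (g : {ffun F -> seq_sub r}) : {ffun F -> R[i]} := [ffun x => val (g x)].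
apply: (@sub_finite_set _ _ (f @` setT)); last first.
  by apply: finite_image; exact: finite_finset.
move=> chi [chi0 chiN0 chiM].
have chi1 : chi 1 = 1.
  have h := chiM 1 1 (oner_neq0 F) (oner_neq0 F).
  by apply: (mulfI (chiN0 1 (oner_neq0 F))); rewrite -h !mulr1.
have chiX x n : chi (x ^+ n.+1) = chi x ^+ n.+1.
  have [->|x0] := eqVneq x 0; first by rewrite exprS mul0r chi0 exprS mul0r.
  elim: n => [|n ih]; first by rewrite !expr1.
  by rewrite exprS chiM ?expf_neq0 // ih -exprS.
have rP x : chi x \in r.
  rewrite -root_prod_XsubC -hr rootE !hornerE.
  by rewrite -(prednK (ltnW q1)) -chiX (prednK (ltnW q1)) expf_card subrr.
exists [ffun x => SeqSub (rP x)] => //.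
by apply/ffunP => x; rewrite !ffunE.
Qed.

End Characters.

Arguments mulchars R F : clear implicits.
Arguments epsilon R F : clear implicits.
Arguments quadchar R F : clear implicits.

(* Main.v *)
Require Import Defs.
From mathcomp Require Import all_boot all_order all_algebra.
From mathcomp Require Import all_solvable all_field.
From mathcomp Require Import reals complex.
From mathcomp Require Import finmap classical_sets cardinality fsbigop ring.

Import GRing.Theory.
Local Open Scope ring_scope.

(** Both sides reduce to the cubic character sum
    S = \sum_s phi(s) phi(s + a) phi(s + b).

    On the left, a point s of F has 1 + phi(s) square roots, so summing over
    x ^+ 2 amounts to summing over s with weight 1 + phi(s)
    ([sum_over_squares]). The weight phi(s) gives S. The weight 1 gives
    \sum_s phi(s + a) phi(s + b), which is -1 when a != b: dividing one factor
    by the other turns it into the sum of phi over all of F but 1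
    ([sum_quadchar_shift2]).

    On the right, the substitution x = s / (s - 1) in the Jacobi sum writes
    the binomial coefficient of phi chi over chi as
    q^-1 \sum_s phi(s) phi(s - 1) chi(s), that is, as the value at chi of the
    Mellin transform of s |-> phi(s) phi(s - 1) ([char_binom_mulr]). By
    orthogonality of characters, the sum over chi of a product of two such
    transforms and of chi(z) is a multiplicative convolution
    ([sum_mulchars_convolution]); the hypergeometric value at z is thus
    q^-1 \sum_(s != 0) phi(s) phi(s - 1) phi(1 - s z)
    ([hypergeo2F1_quadchar]). With z = a / b, the substitution s = - b / t
    turns that sum into phi(b) S.

    Orthogonality and the multiplicativity of phi both rest on a generator g
    of the cyclic group of nonzero elements of F: a character is determined by
    its value at g, an arbitrary (q - 1)-th root of unity, and phi maps g ^+ k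
    to (-1) ^+ k. *)

(** * Primitive roots *)

Lemma prim_root_finField (F : finFieldType) :
  exists g : F, #|F|.-1.-primitive_root g.
Proof.
have n_gt0 : (0 < #|F|.-1)%N by rewrite -subn1 subn_gt0 finNzRing_gt1.
have rt : all #|F|.-1.-unity_root (rem (0 : F) (enum F)).
  apply/allP=> x; rewrite mem_rem_uniq ?enum_uniq // inE => /andP[x0 _].
  apply/unity_rootP; apply: (mulfI x0); rewrite mulr1 -exprS.
  by rewrite (ltn_predK (finNzRing_gt1 F)) expf_card.
have [| |g _ gP] := hasP (has_prim_root n_gt0 rt _ _); last by exists g.
- by rewrite rem_uniq ?enum_uniq.
- by rewrite size_rem ?mem_enum // -cardE.
Qed.

Lemma prim_root_numClosed (C : numClosedFieldType) (n : nat) :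
  (0 < n)%N -> exists w : C, n.-primitive_root w.
Proof.
move=> n_gt0; have [r Dp] := closed_field_poly_normal ('X^n - 1 : {poly C}).
rewrite (monicP _) ?monicXnsubC // scale1r in Dp.
have rn1 : all n.-unity_root r.
  by apply/allP=> z; rewrite -root_prod_XsubC -Dp.
have sz_r : (n < (size r).+1)%N.
  by rewrite -(size_prod_XsubC r id) -Dp size_XnsubC.
have [|w _ wP] := hasP (has_prim_root n_gt0 rn1 _ sz_r); last by exists w.
rewrite -separable_prod_XsubC -Dp cyclotomic.separable_Xn_sub_1 //.
by rewrite Num.Theory.pnatr_eq0 -lt0n.
Qed.

Lemma finField_odd_neq2 (F : finFieldType) : odd #|F| -> 2 != 0 :> F.
Proof.
move=> oddF; apply/negP=> /eqP F2.
have p2 : 2%N \in [pchar F] by rewrite inE /= F2 eqxx.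
move: oddF (finNzRing_gt1 F); rewrite (card_pprimeChar p2) oddX orbF.
by move=> /eqP->.
Qed.

Section Generator.

Variables (F : finFieldType) (g : F).
Hypothesis gP : #|F|.-1.-primitive_root g.

Lemma generator_neq0 : g != 0.
Proof.
apply/eqP=> g0; have /eqP := prim_expr_order gP.
by rewrite g0 expr0n eqn0Ngt (prim_order_gt0 gP) eq_sym oner_eq0.
Qed.

Lemma generator_logP (x : F) : x != 0 -> exists k : 'I_#|F|.-1, x = g ^+ k.
Proof.
move=> x0; have [|k ->] := prim_rootP gP (_ : x ^+ #|F|.-1 = 1).
  apply: (mulfI x0); rewrite mulr1 -exprS.
  by rewrite (ltn_predK (finNzRing_gt1 F)) expf_card.
by exists k.
Qed.

End Generator.

(** * Multiplicative characters *)

Section MulcharTheory.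

Variables (R : realType) (F : finFieldType) (chi : {ffun F -> R[i]}).
Hypothesis chiP : mulchars R F chi.

Lemma mulchar0 : chi 0 = 0. Proof. by case: chiP. Qed.

Lemma mulchar1 : chi 1 = 1.
Proof.
have [_ chiN0 chiM] := chiP; have h := chiM 1 1 (oner_neq0 F) (oner_neq0 F).
by apply: (mulfI (chiN0 1 (oner_neq0 F))); rewrite -h !mulr1.
Qed.

Lemma mulcharM (x y : F) : chi (x * y) = chi x * chi y.
Proof.
have [chi0 _ chiM] := chiP.
have [->|x0] := eqVneq x 0; first by rewrite mul0r chi0 mul0r.
have [->|y0] := eqVneq y 0; first by rewrite mulr0 chi0 mulr0.
exact: chiM.
Qed.

Lemma mulcharX (x : F) (k : nat) : chi (x ^+ k) = chi x ^+ k.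
Proof.
elim: k => [|k IHk]; first by rewrite !expr0 mulchar1.
by rewrite !exprS mulcharM IHk.
Qed.

Lemma mulcharV (x : F) : chi x^-1 = (chi x)^-1.
Proof.
have [->|x0] := eqVneq x 0; first by rewrite invr0 mulchar0 invr0.
have [_ chiN0 _] := chiP; apply: (mulfI (chiN0 x x0)).
by rewrite -mulcharM !mulfV ?chiN0 // mulchar1.
Qed.

Lemma mul_epsilon_mulchar : epsilon R F * chi = chi.
Proof.
apply/ffunP=> x; rewrite !ffunE.
by case: eqVneq => [->|_]; rewrite ?mulchar0 ?mulr0 ?mul1r.
Qed.

(** In the Jacobi sum, chi is evaluated at x and its inverse at 1 - x, so
    that with the factor chi(-1) it only sees s = x / (x - 1). The map
    x |-> x / (x - 1) is an involution of the complement of 1, hence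
    x = s / (s - 1). *)
Lemma char_binom_mulr (A : {ffun F -> R[i]}) :
  char_binom (A * chi) chi =
    #|F|%:R^-1 * \sum_(s | s != 1) A (s / (s - 1)) * chi s.
Proof.
rewrite /char_binom [chi (-1) / _]mulrC -mulrA; congr (_ * _).
rewrite /jacobi_sum mulr_sumr.
rewrite (bigD1 1) //= subrr !ffunE mulchar0 invr0 !mulr0 add0r.
have invoB1 (s : F) : s != 1 -> s / (s - 1) - 1 = (s - 1)^-1.
  by rewrite -subr_eq0 => d0; field.
rewrite (reindex_onto (fun s => s / (s - 1)) (fun s => s / (s - 1))) /=.
  apply: eq_big => [s | s].
    have [->|s1] := eqVneq s 1.
      by rewrite subrr invr0 mulr0 mul0r [0 == 1]eq_sym oner_eq0.
    rewrite -subr_eq0 invoB1 // invrK mulfVK ?subr_eq0 // eqxx andbT.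
    by rewrite invr_eq0 subr_eq0.
  rewrite !ffunE => /andP[_ /eqP sK].
  rewrite -mulrA mulrCA -mulcharV -!mulcharM; congr (_ * chi _).
  rewrite -[RHS]sK.
  by rewrite -[1 - _]opprB invrN mulrN -mulrA mulN1r opprK.
by move=> s s1; rewrite invoB1 // invrK mulfVK ?subr_eq0.
Qed.

End MulcharTheory.

(** * Orthogonality *)

Section Enumeration.

Variables (R : realType) (F : finFieldType) (g : F) (w : R[i]).
Let n := #|F|.-1.
Hypothesis gP : n.-primitive_root g.
Hypothesis wP : n.-primitive_root w.

Let n_gt0 : (0 < n)%N. Proof. exact: prim_order_gt0 gP. Qed.

(** The character sending the generator g to w ^+ i. The search for a
    logarithm fails only at 0, so this is 0 there. *)
Definition powchar (i : 'I_n) : {ffun F -> R[i]} :=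
  [ffun x => if [pick k : 'I_n | x == g ^+ k] is Some k then w ^+ (i * k)
             else 0].

Lemma powcharE (i : 'I_n) (k : nat) : powchar i (g ^+ k) = w ^+ (i * k).
Proof.
rewrite ffunE; case: pickP => [j | /(_ (Ordinal (ltn_pmod k n_gt0)))] /=.
  rewrite (eq_prim_root_expr gP) => /eqP kj.
  by apply/eqP; rewrite (eq_prim_root_expr wP) -modnMmr -kj modnMmr.
by rewrite (prim_expr_mod gP) eqxx.
Qed.

Lemma powchar0 (i : 'I_n) : powchar i 0 = 0.
Proof.
rewrite ffunE; case: pickP => // k.
by rewrite eq_sym expf_eq0 (negPf (generator_neq0 F g gP)) andbF.
Qed.

Lemma powchar_mulchar (i : 'I_n) : mulchars R F (powchar i).
Proof.
split=> [|x /(generator_logP F g gP)[k ->]|x y]; first exact: powchar0.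
  rewrite powcharE expf_neq0 //; apply/eqP=> w0.
  have /eqP := prim_expr_order wP.
  by rewrite w0 expr0n eqn0Ngt n_gt0 eq_sym oner_eq0.
move=> /(generator_logP F g gP)[j ->] /(generator_logP F g gP)[k ->].
by rewrite -exprD !powcharE mulnDr exprD.
Qed.

Lemma powchar_inj : injective powchar.
Proof.
move=> i j /ffunP/(_ (g ^+ 1)); rewrite !powcharE !muln1 => /eqP.
by rewrite (eq_prim_root_expr wP) !modn_small // => /eqP/val_inj.
Qed.

(** The value of chi at g is an n-th root of unity, hence a power of w, and it
    determines chi. *)
Lemma mulchar_powchar (chi : {ffun F -> R[i]}) :
  mulchars R F chi -> exists i, chi = powchar i.
Proof.
move=> chiP; have [|i chi_g] := prim_rootP wP (_ : chi g ^+ n = 1).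
  by rewrite -mulcharX // (prim_expr_order gP) mulchar1.
exists i; apply/ffunP=> x.
have [->|/(generator_logP F g gP)[k ->]] := eqVneq x 0.
  by rewrite powchar0; case: chiP.
by rewrite powcharE mulcharX // chi_g exprM.
Qed.

Lemma fsbig_mulchars (G : {ffun F -> R[i]} -> R[i]) :
  \sum_(chi \in mulchars R F) G chi = \sum_(i < n) G (powchar i).
Proof.
have A_r : mulchars R F = [set` map powchar (enum 'I_n)]%classic.
  apply/seteqP; split=> [chi /mulchar_powchar[i ->] | chi /= /mapP[i _ ->]].
    by rewrite /= map_f ?mem_enum.
  exact: powchar_mulchar.
rewrite A_r -fsbig_seq ?big_map ?big_enum //.
by rewrite map_inj_uniq ?enum_uniq //; exact: powchar_inj.
Qed.

(** For z = g ^+ k this is the geometric sum of ratio w ^+ k, a ratio which is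
    1 exactly when z is. *)
Lemma sum_powchar (z : F) :
  \sum_(i < n) powchar i z = if z == 1 then n%:R else 0.
Proof.
have [-> | z0] := eqVneq z 0.
  by rewrite eq_sym oner_eq0 big1 // => i _; rewrite powchar0.
have [k ->] := generator_logP F g gP z z0.
under eq_bigr => i _ do rewrite powcharE mulnC exprM.
have -> : (g ^+ k == 1) = (w ^+ k == 1).
  by rewrite -(prim_order_dvd gP) (prim_order_dvd wP).
have [->|wk] := eqVneq (w ^+ k) 1.
  by under eq_bigr => i _ do rewrite expr1n; rewrite sumr_const card_ord.
apply: (mulfI (x := w ^+ k - 1)); first by rewrite subr_eq0.
by rewrite mulr0 -subrX1 exprAC (prim_expr_order wP) expr1n subrr.
Qed.

End Enumeration.

Lemma sum_mulchars (R : realType) (F : finFieldType) (z : F) :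
  \sum_(chi \in mulchars R F) chi z = if z == 1 then #|F|.-1%:R else 0.
Proof.
have [g gP] := prim_root_finField F.
have [w wP] := prim_root_numClosed R[i] #|F|.-1 (prim_order_gt0 gP).
by rewrite (fsbig_mulchars R F g w gP wP) (sum_powchar R F g w gP wP).
Qed.

(** Mellin transforms multiply like convolutions: expanding the products leaves
    chi (s * z * t), whose sum over chi only keeps the pairs (s, t) with
    s * z * t = 1. *)
Lemma sum_mulchars_convolution (R : realType) (F : finFieldType)
    (f h : F -> R[i]) (z : F) : z != 0 ->
  \sum_(chi \in mulchars R F)
      (\sum_s f s * chi s) * (\sum_t h t * chi t) * chi z =
  #|F|.-1%:R * \sum_(s | s != 0) f s * h (s * z)^-1.
Proof.
move=> z0; have fin := @finite_mulchars R F.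
transitivity (\sum_(chi \in mulchars R F)
    \sum_s \sum_t f s * h t * chi (s * z * t)).
  apply: eq_fsbigr => chi; rewrite inE => chiP.
  rewrite -mulrA mulr_suml; apply: eq_bigr => s _.
  rewrite mulr_suml mulr_sumr; apply: eq_bigr => t _.
  by rewrite !(mulcharM R F chi chiP); ring.
rewrite fsbig_finite //= exchange_big /= mulr_sumr [LHS](bigD1 0) //=.
rewrite big1_seq ?add0r => [|chi /=]; last first.
  rewrite in_fset_set // inE => chiP.
  by rewrite big1 // => t _; rewrite !mul0r (mulchar0 R F chi chiP) mulr0.
apply: eq_bigr => s s0; rewrite exchange_big /= (bigD1 (s * z)^-1) //=.
have sumE t : \sum_(chi <- fset_set (mulchars R F)) f s * h t * chi (s * z * t)
    = f s * h t * if s * z * t == 1 then #|F|.-1%:R else 0.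
  by rewrite -mulr_sumr -sum_mulchars fsbig_finite.
have sz0 : s * z != 0 by rewrite mulf_neq0.
rewrite sumE big1 ?addr0 => [|t t_neq]; rewrite ?sumE.
  by rewrite mulfV // eqxx mulrC.
rewrite ifN ?mulr0 //; apply: contraNneq t_neq => szt.
by apply/eqP/(mulfI sz0); rewrite szt mulfV.
Qed.

(** * The quadratic character *)

(** As the order of g is even, the parity of the exponent of a power of g is
    well defined, and squares are the even powers. *)
Lemma quadchar_generator (R : realType) (F : finFieldType) (g : F) (k : nat) :
  #|F|.-1.-primitive_root g -> odd #|F| -> quadchar R F (g ^+ k) = (-1) ^+ k.
Proof.
move=> gP oddF; have even_n : odd #|F|.-1 = false.
  by move: oddF; rewrite -(ltn_predK (finNzRing_gt1 F)) /= => /negPf.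
have g0 := generator_neq0 F g gP.
rewrite ffunE expf_eq0 (negPf g0) andbF -signr_odd.
case: existsP => [[y /eqP gky] | no_root].
  have [j yj] : exists j : 'I_#|F|.-1, y = g ^+ j.
    apply: (generator_logP F g gP); apply: contraNneq g0 => y0.
    have /eqP: g ^+ k = 0 by rewrite gky y0 expr0n.
    by rewrite expf_eq0 => /andP[].
  move: gky; rewrite yj -exprM => /eqP; rewrite (eq_prim_root_expr gP).
  move=> /eqP/(congr1 odd); rewrite !odd_mod // oddM andbF.
  by move->.
case k_odd: (odd k) => //; case: no_root; exists (g ^+ k./2).
by rewrite -exprM muln2 even_halfK ?k_odd.
Qed.

Section QuadraticCharacter.

Variables (R : realType) (F : finFieldType).
Hypothesis oddF : odd #|F|.
Local Notation phi := (quadchar R F).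

Lemma quadchar0 : phi 0 = 0. Proof. by rewrite ffunE eqxx. Qed.

Lemma quadchar_sqr (x : F) : x != 0 -> phi (x ^+ 2) = 1.
Proof.
move=> x0; rewrite ffunE expf_eq0 (negPf x0) andbF ifT //.
by apply/existsP; exists x.
Qed.

Lemma quadchar_mulchar : mulchars R F phi.
Proof.
have [g gP] := prim_root_finField F.
split=> [|x /(generator_logP F g gP)[i ->]|x y]; first exact: quadchar0.
  by rewrite quadchar_generator // signr_eq0.
move=> /(generator_logP F g gP)[i ->] /(generator_logP F g gP)[j ->].
by rewrite -exprD !quadchar_generator // exprD.
Qed.

Definition quadcharM := mulcharM R F phi quadchar_mulchar.

Lemma quadchar_div (x y : F) : phi (x / y) = phi x * phi y.
Proof.
have [->|y0] := eqVneq y 0; first by rewrite invr0 mulr0 quadchar0 mulr0.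
rewrite -[LHS]mulr1 -(quadchar_sqr y y0) -!quadcharM; congr (phi _).
by rewrite expr2 mulrA mulfVK.
Qed.

(** Multiplying the variable by the nonsquare g negates the sum. *)
Lemma sum_quadchar : \sum_x phi x = 0.
Proof.
have [g gP] := prim_root_finField F.
have phi_g : phi g = -1 by rewrite -[g]expr1 quadchar_generator // expr1.
have : \sum_x phi x = - \sum_x phi x.
  rewrite {1}(reindex_inj (mulfI (generator_neq0 F g gP))) -mulN1r mulr_sumr.
  by apply: eq_bigr => x _; rewrite quadcharM phi_g.
by move/eqP; rewrite -subr_eq0 opprK -mulr2n Num.Theory.mulrn_eq0 => /eqP.
Qed.

(** Each nonzero summand is phi ((s + c) / s) = phi (1 + c / s), where c / s
    runs over the nonzero elements: only the value phi 1 is missing from a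
    complete sum of phi. *)
Lemma sum_quadchar_shift (c : F) : c != 0 ->
  \sum_s phi s * phi (s + c) = -1.
Proof.
move=> c0; rewrite (bigD1 0) //= quadchar0 mul0r add0r.
have cK (t : F) : c / (c / t) = t by rewrite invf_div mulrC mulfVK.
transitivity (\sum_(t | t != 0) phi (t + 1)).
  rewrite (reindex_onto (fun t => c / t) (fun t => c / t)) //=.
  apply: eq_big => [t|t /andP[ct0 _]].
    by rewrite cK eqxx andbT mulf_eq0 negb_or c0 invr_eq0.
  by rewrite mulrC -quadchar_div mulrDl mulfV // cK addrC.
have := sum_quadchar; rewrite (reindex_inj (addIr 1)) /=.
rewrite (bigD1 0) //= add0r -{1}[1](expr1n _ 2) quadchar_sqr ?oner_neq0 //.
by rewrite addrC => /eqP; rewrite addr_eq0 => /eqP.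
Qed.

Lemma sum_quadchar_shift2 (a b : F) : a != b ->
  \sum_s phi (s + a) * phi (s + b) = -1.
Proof.
move=> ab; rewrite -(sum_quadchar_shift (b - a)) ?subr_eq0 1?eq_sym //.
rewrite [RHS](reindex_inj (addIr a)) /=.
by apply: eq_bigr => s _; rewrite -addrA subrKC.
Qed.

Lemma card_sqrt (s : F) : (#|[pred x | x ^+ 2 == s]|)%:R = 1 + phi s.
Proof.
rewrite ffunE; have [->|s0] := eqVneq s 0.
  rewrite addr0 (@eq_card _ _ (pred1 (0 : F))) ?card1 // => x.
  by rewrite !inE expf_eq0.
case: existsP => [[y /eqP sy]|no_root].
  have y0 : y != 0 by apply: contraNneq s0 => y0; rewrite sy y0 expr0n.
  have yNy : y != - y.
    rewrite -addr_eq0 -mulr2n -mulr_natl mulf_neq0 //.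
    exact: finField_odd_neq2.
  rewrite (@eq_card _ _ (pred2 y (- y))) ?card2 ?yNy // => x.
  by rewrite !inE sy eqf_sqr.
rewrite subrr eq_card0 // => x; rewrite !inE.
by apply/negP=> /eqP xs; apply: no_root; exists x; rewrite xs.
Qed.

Lemma sum_over_squares (f : F -> R[i]) :
  \sum_x f (x ^+ 2) = \sum_s (1 + phi s) * f s.
Proof.
rewrite (partition_big (fun x => x ^+ 2) predT) //=; apply: eq_bigr => s _.
rewrite -card_sqrt mulr_natl -sumr_const.
by apply: eq_bigr => x /eqP->.
Qed.

(** * The hypergeometric function of the quadratic character *)

(** The convolution formula applies to f s = phi s * phi (s - 1), for which
    f (s * z)^-1 = phi (1 - s * z) because phi ignores the square of
    (s * z)^-1. *)
Lemma hypergeo2F1_quadchar (z : F) : z != 0 ->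
  #|F|%:R * hypergeo2F1 phi phi (epsilon R F) z =
  \sum_(s | s != 0) phi s * phi (s - 1) * phi (1 - s * z).
Proof.
move=> z0; pose f s := phi s * phi (s - 1).
have q0 : #|F|%:R != 0 :> R[i].
  by rewrite Num.Theory.pnatr_eq0 -lt0n ltnW ?finNzRing_gt1.
have n0 : #|F|.-1%:R != 0 :> R[i].
  by rewrite Num.Theory.pnatr_eq0 -lt0n -subn1 subn_gt0 finNzRing_gt1.
have qB1 : #|F|%:R - 1 = #|F|.-1%:R :> R[i].
  by rewrite -subn1 natrB // ltnW ?finNzRing_gt1.
have binomE chi : mulchars R F chi ->
    char_binom (phi * chi) chi = #|F|%:R^-1 * \sum_s f s * chi s.
  move=> chiP; rewrite char_binom_mulr //; congr (_ * _).
  rewrite [RHS](bigD1 1) //= /f subrr quadchar0 mulr0 mul0r add0r.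
  by apply: eq_bigr => s _; rewrite quadchar_div.
rewrite /hypergeo2F1 qB1.
have -> : \sum_(chi \in mulchars R F) char_binom (phi * chi) chi *
      char_binom (phi * chi) (epsilon R F * chi) * chi z =
    #|F|%:R^-1 ^+ 2 * (#|F|.-1%:R * \sum_(s | s != 0) f s * f (s * z)^-1).
  rewrite -sum_mulchars_convolution // mulr_fsumr; apply: eq_fsbigr => chi.
  by rewrite inE => chiP; rewrite mul_epsilon_mulchar // binomE //; ring.
have -> : \sum_(s | s != 0) phi s * phi (s - 1) * phi (1 - s * z) =
          \sum_(s | s != 0) f s * f (s * z)^-1.
  apply: eq_bigr => s s0; congr (_ * _).
  have sz0 : s * z != 0 by rewrite mulf_neq0.
  rewrite /f -quadcharM -[LHS]mulr1 -(quadchar_sqr (s * z)^-1) ?invr_eq0 //.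
  by rewrite -quadcharM; congr (phi _); field; rewrite z0 s0.
by field; rewrite q0 n0.
Qed.

End QuadraticCharacter.

Theorem proposition4p4 (R : realType) (F : finFieldType) (p r : nat)
    (p_prime : prime p) (p_odd : odd p) (r_gt0 : (0 < r)%N)
    (card_F : #|F| = (p ^ r)%N) (a b : F)
    (a_neq0 : a != 0) (b_neq0 : b != 0) (a_neq_b : a != b) :
  \sum_(x : F) quadchar R F (x ^+ 2 + a) * quadchar R F (x ^+ 2 + b) =
  #|F|%:R * quadchar R F b *
    hypergeo2F1 (quadchar R F) (quadchar R F) (epsilon R F) (a / b) - 1.
Proof.
have oddF : odd #|F| by rewrite card_F oddX p_odd orbT.
have phiM := quadcharM R F oddF.
rewrite (sum_over_squares R F oddF
  (fun s => quadchar R F (s + a) * quadchar R F (s + b))).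
under eq_bigr => s _ do rewrite mulrDl mul1r.
rewrite big_split /= sum_quadchar_shift2 // addrC; congr (_ - 1).
rewrite mulrAC hypergeo2F1_quadchar ?mulf_neq0 ?invr_eq0 //.
rewrite (bigD1 0) //= quadchar0 mul0r add0r mulr_suml.
have bK (t : F) : - b / (- b / t) = t.
  by rewrite invf_div mulrC mulfVK ?oppr_eq0.
rewrite [RHS](reindex_onto (fun t => - b / t) (fun t => - b / t)) //=.
apply: eq_big => [t|t t0].
  by rewrite bK eqxx andbT mulf_eq0 negb_or oppr_eq0 b_neq0 invr_eq0.
(* The arguments of phi on the two sides differ by the square of b / t ^+ 2:
   on the right, (- b / t) * (- (b + t) / t) * ((t + a) / t) * b. *)
rewrite -!phiM -[LHS]mulr1 -(quadchar_sqr R F (b / t ^+ 2)).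
  by rewrite -!phiM; congr (quadchar R F _); field; rewrite b_neq0.
by rewrite mulf_neq0 ?invr_eq0 ?expf_neq0.
Qed.
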